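(* Let $A,B\in\mathbb{R}^{n\times n}$ with $A-B$ nonsingular, and suppose that $Q:=(A^{\mathsf T}+B^{\mathsf T})(A^{\mathsf T}-B^{\mathsf T})^{-1}$ is a nondegenerate matrix. Let $\Omega:=\{w=(u,v)\in\mathbb{R}^n\times\mathbb{R}^n:(u_i,v_i)\notin\mathbb{R}^2_{--}\ \ \forall i=1,\dots,n\}$. Then for any $c\in\mathbb{R}^n$, $$\operatorname{Fix}(P_{C_1}\circ P_{C_2})\cap\Omega=C_1\cap C_2 .$$
   Context: A square matrix is nondegenerate if all its principal minors are nonzero. $\mathbb{R}^2_{--}=\{(a,b)\in\mathbb{R}^2:a<0,\ b<0\}$. With $T=[\,A+B\;\;\;-A+B\,]\in\mathbb{R}^{n\times 2n}$, $C_1:=\{w\in\mathbb{R}^n\times\mathbb{R}^n: Tw=\sqrt2\,c\}$ and $C_2:=\{w=(u,v)\in\mathbb{R}^n\times\mathbb{R}^n: u\ge 0,\ v\ge 0,\ \langle u,v\rangle=0\}$ (inequalities componentwise). For a set $S$, $P_S(z):=\{s\in S:\|s-z\|\le\|t-z\|\ \forall t\in S\}$ is the (possibly multivalued) Euclidean metric projector. $(P_{C_1}\circ P_{C_2})(w)=\bigcup_{w'\in P_{C_2}(w)}P_{C_1}(w')$, and $\operatorname{Fix}(P_{C_1}\circ P_{C_2})=\{w: w\in(P_{C_1}\circ P_{C_2})(w)\}$. *)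

(* Defs.v *)
From mathcomp Require Import all_boot all_order all_algebra.
From mathcomp Require Import classical_sets reals.

Set Implicit Arguments.
Unset Strict Implicit.
Unset Printing Implicit Defensive.

Import Order.TTheory GRing.Theory Num.Theory.

Local Open Scope ring_scope.
Local Open Scope classical_set_scope.

(* The principal minor on the empty index set equals 1, so quantifying over
   all index sets or over the nonempty ones gives the same predicate. *)
Definition principal_minor (R : realType) (n : nat) (M : 'M[R]_n)
    (I : {set 'I_n}) : R :=
  \det (mxsub (fun k : 'I_#|I| => enum_val k) (fun k : 'I_#|I| => enum_val k) M).

Definition nondegenerate_mx (R : realType) (n : nat) (M : 'M[R]_n) : Prop :=
  forall I : {set 'I_n}, principal_minor M I != 0.

Definition inner (R : realType) (m : nat) (x y : 'cV[R]_m) : R :=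
  \sum_(i < m) x i 0 * y i 0.

(* The norm that MathComp-Analysis puts on matrices is the sup norm, hence a
   separate Euclidean norm. *)
Definition enorm (R : realType) (m : nat) (x : 'cV[R]_m) : R :=
  Num.sqrt (inner x x).

Definition metric_proj (R : realType) (m : nat) (S : set 'cV[R]_m)
    (z : 'cV[R]_m) : set 'cV[R]_m :=
  [set s | S s /\ forall t, S t -> enorm (s - z) <= enorm (t - z)].

Definition mcomp (X Y Z : Type) (F : Y -> set Z) (G : X -> set Y) : X -> set Z :=
  fun x => \bigcup_(y in G x) F y.

Definition Fix (X : Type) (F : X -> set X) : set X := [set x | F x x].

(* A pair w = (u, v) in R^n x R^n is the stacked column vector col_mx u v,
   so that u = usubmx w and v = dsubmx w. *)
Definition Tmx (R : realType) (n : nat) (A B : 'M[R]_n) : 'M[R]_(n, n + n) :=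
  row_mx (A + B) (- A + B).

Definition C1 (R : realType) (n : nat) (A B : 'M[R]_n) (c : 'cV[R]_n) :
    set 'cV[R]_(n + n) :=
  [set w : 'cV[R]_(n + n) | Tmx A B *m w = Num.sqrt 2 *: c].

Definition C2 (R : realType) (n : nat) : set 'cV[R]_(n + n) :=
  [set w : 'cV[R]_(n + n) | [/\ forall i, 0 <= usubmx w i 0,
               forall i, 0 <= dsubmx w i 0
             & inner (usubmx w) (dsubmx w) = 0]].

Definition neg_quadrant (R : realType) : set (R * R) :=
  [set p | p.1 < 0 /\ p.2 < 0].

Definition Omega (R : realType) (n : nat) : set 'cV[R]_(n + n) :=
  [set w : 'cV[R]_(n + n) | forall i : 'I_n, ~ neg_quadrant (usubmx w i 0, dsubmx w i 0)].

Arguments C2 : clear implicits.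
Arguments neg_quadrant : clear implicits.
Arguments Omega : clear implicits.

(* Main.v *)
Require Import Defs.
From mathcomp Require Import all_boot all_order all_algebra.
From mathcomp Require Import classical_sets reals.
From mathcomp Require Import ring lra.

Import Order.TTheory GRing.Theory Num.Theory.

Local Open Scope ring_scope.
Local Open Scope classical_set_scope.

(** Let [w] be a fixed point lying in [Omega], let [w'] be the nearest point of
    [C2] from which it comes, and write [w - w' = (p, q)].

    Two independent facts constrain [(p, q)].  As [w] is the projection of [w']
    on the affine space [C1], [(p, q)] is orthogonal to [ker T]; since [A - B]
    is invertible, [ker T] is the graph of [Q^T], so this orthogonality reads
    [p = - Q q] ([C1_proj_residual]).  As [w'] is a projection of [w] on [C2],
    a product of planar crosses, and no pair [(u_i, v_i)] is in the open
    negative quadrant, each planar projection moves at most one of the two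
    coordinates, so [p_i q_i = 0] for all [i] ([C2_proj_residual]).

    Hence [q_i (Q q)_i = 0] for all [i].  On the support [I] of [q] this is the
    homogeneous linear system with matrix [Q_II], which is invertible by
    nondegeneracy, so [q = 0] ([nondegenerate_hadamard0]).  Then [p = 0], and
    [w = w'] belongs to both sets.  Conversely, a common point of [C1] and [C2]
    is its own projection on each of them. *)

(** * Inner product and projections on arbitrary sets *)

Lemma inner_ge0 (R : realType) (m : nat) (x : 'cV[R]_m) : 0 <= inner x x.
Proof. by apply: sumr_ge0 => i _; rewrite -expr2 sqr_ge0. Qed.

Lemma inner_eq0 (R : realType) (m : nat) (x : 'cV[R]_m) :
  inner x x = 0 -> x = 0.
Proof.
move=> /psumr_eq0P x0; apply/matrixP => i j; rewrite ord1 mxE.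
have /eqP : x i 0 * x i 0 = 0 by apply: x0 => // k _; rewrite -expr2 sqr_ge0.
by rewrite mulf_eq0 orbb => /eqP.
Qed.

Lemma innerDD (R : realType) (m : nat) (x y : 'cV[R]_m) (s : R) :
  inner (x + s *: y) (x + s *: y)
  = inner x x + (2 * s * inner x y + s ^+ 2 * inner y y).
Proof.
rewrite /inner !mulr_sumr -!big_split /=; apply: eq_bigr => i _.
by rewrite !mxE; ring.
Qed.

Lemma inner_mxE (R : realType) (m : nat) (x y : 'cV[R]_m) :
  inner x y = (x^T *m y) 0 0.
Proof. by rewrite mxE; apply: eq_bigr => i _; rewrite mxE. Qed.

Lemma inner_col (R : realType) (m n : nat) (x y : 'cV[R]_(m + n)) :
  inner x y = inner (usubmx x) (usubmx y) + inner (dsubmx x) (dsubmx y).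
Proof.
by rewrite /inner big_split_ord; congr (_ + _); apply: eq_bigr => i _; rewrite !mxE.
Qed.

Lemma enorm_le (R : realType) (m : nat) (x y : 'cV[R]_m) :
  (enorm x <= enorm y) = (inner x x <= inner y y).
Proof. by rewrite ler_sqrt // inner_ge0. Qed.

Lemma metric_proj_id (R : realType) (m : nat) (S : set 'cV[R]_m) (z : 'cV[R]_m) :
  S z -> metric_proj S z z.
Proof.
move=> Sz; split=> // t _; rewrite enorm_le subrr.
by rewrite {1}/inner big1 ?inner_ge0 // => i _; rewrite mxE mul0r.
Qed.

(** First-order optimality condition: the squared distance to [z] is minimal
    at [s] along the line [s + k d], so its derivative there vanishes. *)
Lemma metric_proj_orthogonal (R : realType) (m : nat) (S : set 'cV[R]_m)
    (z s d : 'cV[R]_m) :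
  metric_proj S z s -> (forall k, S (s + k *: d)) -> inner (s - z) d = 0.
Proof.
move=> [_ smin] Sline; set a := inner _ d; set b := inner d d.
have b0 : 0 <= b := inner_ge0 _ _ d.
have b1 : 0 < b + 1 by lra.
(* This step along the line is downhill unless [a = 0]; the [+ 1] covers
   [d = 0]. *)
pose k := - a / (b + 1).
have := smin _ (Sline k).
rewrite addrAC enorm_le innerDD -/a -/b lerDl.
have -> : 2 * k * a + k ^+ 2 * b = - (a ^+ 2 * (b + 2) / (b + 1) ^+ 2).
  by rewrite /k; field; rewrite gt_eqF.
rewrite oppr_ge0 pmulr_lle0 ?invr_gt0 ?exprn_gt0 // pmulr_lle0; last by lra.
by rewrite exprn_even_le0 // => /eqP.
Qed.

(** * Nondegenerate matrices *)

(** Restricted to the support of [y], the hypothesis is a homogeneous linear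
    system whose matrix is a principal submatrix of [M], hence invertible. *)
Lemma nondegenerate_hadamard0 (R : realType) (n : nat) (M : 'M[R]_n)
    (y : 'cV[R]_n) :
  nondegenerate_mx M -> (forall i, y i 0 * (M *m y) i 0 = 0) -> y = 0.
Proof.
move=> ndM yMy; pose I := [set i | y i 0 != 0]%SET.
pose MI := mxsub (fun k : 'I_#|I| => enum_val k) (fun k : 'I_#|I| => enum_val k) M.
pose yI : 'cV[R]_#|I| := \col_k y (enum_val k) 0.
have unitMI : MI \in unitmx by rewrite unitmxE unitfE; exact: ndM.
have MyI : MI *m yI = 0.
  apply/matrixP => k j; rewrite ord1 !mxE.
  have : y (enum_val k) 0 != 0 by have := enum_valP k; rewrite inE.
  move=> yk0; have /eqP := yMy (enum_val k).
  rewrite mulf_eq0 (negPf yk0) /= mxE => /eqP My0.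
  rewrite -[RHS]My0 [RHS](bigID (mem I)) /= [X in _ + X]big1 ?addr0; last first.
    by move=> i; rewrite inE negbK => /eqP ->; rewrite mulr0.
  rewrite [RHS]big_enum_val /=.
  by apply: eq_bigr => i _; rewrite !mxE.
have yI0 : yI = 0 by rewrite -(mulKmx unitMI yI) MyI mulmx0.
apply/matrixP => i j; rewrite ord1 [RHS]mxE; apply/eqP/negPn/negP => yi0.
have iI : i \in I by rewrite inE.
have := congr1 (fun z : 'cV[R]_#|I| => z (enum_rank_in iI i) 0) yI0.
by rewrite !mxE enum_rankK_in // => /eqP; apply/negP.
Qed.

(** * Projection on the affine space C1 *)

(** The kernel of [T = (A + B, - A + B)] is the graph of
    [(A - B)^-1 (A + B) = Q^T], whose orthogonal complement is
    [{(p, q) | p = - Q q}]. *)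
Lemma C1_proj_residual (R : realType) (n : nat) (A B : 'M[R]_n)
    (c : 'cV[R]_n) (z w : 'cV[R]_(n + n)) :
  A - B \in unitmx -> metric_proj (C1 A B c) z w ->
  usubmx (w - z)
  = - ((A^T + B^T) *m invmx (A^T - B^T) *m dsubmx (w - z)).
Proof.
move=> uAB wproj; set Q := _ *m invmx _.
have QT : Q^T = invmx (A - B) *m (A + B).
  by rewrite /Q trmx_mul trmx_inv !linearB !linearD /= !trmxK.
set p := usubmx _; set q := dsubmx _.
(* The vector of [ker T] above the defect [r], so that orthogonality to it
   alone says that [r] has norm zero. *)
pose r := p + Q *m q; pose d := col_mx r (Q^T *m r).
have Td : Tmx A B *m d = 0.
  rewrite /Tmx /d mul_row_col QT (_ : - A + B = - (A - B)); last first.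
    by rewrite opprB addrC.
  by rewrite mulNmx -mulmxA mulKVmx // subrr.
have rr : inner (w - z) d = inner r r.
  rewrite inner_col /d col_mxKu col_mxKd -/p -/q !inner_mxE.
  have rT : r^T = p^T + q^T *m Q^T by rewrite /r linearD /= trmx_mul.
  by rewrite [in RHS]rT mulmxDl [RHS]mxE mulmxA.
have /inner_eq0 r0 : inner r r = 0.
  rewrite -rr; apply: (metric_proj_orthogonal _ _ _ _ _ _ wproj) => k.
  case: wproj => C1w _; rewrite /C1 /= in C1w *.
  by rewrite mulmxDr -scalemxAr Td scaler0 addr0.
by apply/eqP; rewrite -addr_eq0 -/r r0.
Qed.

(** * Projection on the complementarity set C2 *)

Lemma inner_nonneg_eq0 (R : realType) (n : nat) (x y : 'cV[R]_n) :
  (forall i, 0 <= x i 0) -> (forall i, 0 <= y i 0) ->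
  inner x y = 0 -> forall i, x i 0 * y i 0 = 0.
Proof.
move=> x0 y0 /psumr_eq0P xy i.
by apply: xy => // k _; apply: mulr_ge0.
Qed.

(** Outside the open negative quadrant, one coordinate of [(a, b)] is
    nonnegative, so one of [(a, 0)], [(0, b)] is admissible; the nearest
    admissible point thus keeps one coordinate.  In the negative quadrant this
    fails, the nearest point being the origin. *)
Lemma cross_proj_residual (R : realType) (a b a' b' : R) :
  ~ neg_quadrant R (a, b) -> 0 <= a' -> 0 <= b' -> a' * b' = 0 ->
  (forall s t, 0 <= s -> 0 <= t -> s * t = 0 ->
    (a' - a) ^+ 2 + (b' - b) ^+ 2 <= (s - a) ^+ 2 + (t - b) ^+ 2) ->
  (a - a') * (b - b') = 0.
Proof.
move=> nneg a'0 b'0 a'b' amin.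
have [a0|a0] := lerP 0 a; have [b0|b0] := lerP 0 b.
- move/eqP: a'b'; rewrite mulf_eq0 => /orP[]/eqP e; subst.
    by have := amin 0 b (lexx _) b0 (mul0r _) => h; nra.
  by have := amin a 0 a0 (lexx _) (mulr0 _) => h; nra.
- have h := amin a 0 a0 (lexx _) (mulr0 _).
  have a'a : (a' - a) ^+ 2 <= 0 by nra.
  by move: a'a; rewrite exprn_even_le0 //= subr_eq0 => /eqP ->; rewrite subrr mul0r.
- have h := amin 0 b (lexx _) b0 (mul0r _).
  have b'b : (b' - b) ^+ 2 <= 0 by nra.
  by move: b'b; rewrite exprn_even_le0 //= subr_eq0 => /eqP ->; rewrite subrr mulr0.
- by case: nneg.
Qed.

(** [C2] is a product of planar sets and the squared distance is a sum over
    the factors, so a nearest point is nearest in every factor: compare with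
    the competitor that differs from it in one factor only. *)
Lemma C2_proj_residual (R : realType) (n : nat) (w z : 'cV[R]_(n + n)) :
  Omega R n w -> metric_proj (C2 R n) w z ->
  forall i, usubmx (w - z) i 0 * dsubmx (w - z) i 0 = 0.
Proof.
move=> Ow [[u0 v0 uv0] zmin] i.
have uv := inner_nonneg_eq0 _ _ _ _ u0 v0 uv0.
have subE (x y : 'cV[R]_n) k : (x - y) k 0 = x k 0 - y k 0 by rewrite !mxE.
rewrite !linearB /= !subE.
apply: cross_proj_residual => [|||| s t s0 t0 st]; [exact: Ow|exact: u0|exact: v0|exact: uv|].
pose u' : 'cV[R]_n := \col_k (if k == i then s else usubmx z k 0).
pose v' : 'cV[R]_n := \col_k (if k == i then t else dsubmx z k 0).
have C2' : C2 R n (col_mx u' v').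
  rewrite /C2 /= col_mxKu col_mxKd; split.
  - by move=> k; rewrite [u' _ _]mxE; case: ifP.
  - by move=> k; rewrite [v' _ _]mxE; case: ifP.
  - rewrite /inner big1 // => k _; rewrite [u' _ _]mxE [v' _ _]mxE.
    by case: ifP => _; [exact: st|exact: uv].
have := zmin _ C2'; rewrite enorm_le !inner_col !linearB /= col_mxKu col_mxKd.
rewrite /inner -!big_split /= (bigD1 i) //= [X in _ <= X](bigD1 i) //=.
rewrite [X in _ <= _ + X](eq_bigr (fun k =>
  (usubmx z - usubmx w) k 0 * (usubmx z - usubmx w) k 0
  + (dsubmx z - dsubmx w) k 0 * (dsubmx z - dsubmx w) k 0)); last first.
  by move=> k /negPf ki; rewrite !subE [u' _ _]mxE [v' _ _]mxE ki.
by rewrite lerD2r -!expr2 !subE [u' _ _]mxE [v' _ _]mxE eqxx.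
Qed.

(** * Fixed points of the composed projections *)

Theorem theorem2p12 (R : realType) (n : nat) (A B : 'M[R]_n)
    (hAB : A - B \in unitmx)
    (hQ : nondegenerate_mx ((A^T + B^T) *m invmx (A^T - B^T)))
    (c : 'cV[R]_n) :
  Fix (mcomp (metric_proj (C1 A B c)) (metric_proj (C2 R n))) `&` Omega R n
  = C1 A B c `&` C2 R n.
Proof.
rewrite eqEsubset; split=> [w [[z zw wz] Ow]|w [C1w C2w]]; last first.
  split; first by exists w; apply: metric_proj_id.
  by move=> i [/= + _]; case: C2w => u0 _ _; rewrite ltNge u0.
have p_eq := C1_proj_residual _ _ _ _ _ _ _ hAB wz.
have pq0 := C2_proj_residual _ _ _ _ Ow zw.
have q0 : dsubmx (w - z) = 0.
  apply: nondegenerate_hadamard0 hQ _ => i.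
  move: (pq0 i); rewrite p_eq [X in X * _]mxE mulNr mulrC => /eqP.
  by rewrite oppr_eq0 => /eqP.
have /eqP : w - z = 0.
  by rewrite -[LHS]vsubmxK p_eq q0 mulmx0 oppr0 col_mx0.
rewrite subr_eq0 => /eqP wzE; split; first by case: wz.
by rewrite wzE; case: zw.
Qed.
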